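(* Let $[\mathbf H_N^N]$ be an independent copy of the random matrix $[\mathbf H^N]=[\mathbf H^1\cdots\mathbf H^N]$ with values in $\mathbb M_{\nu,N}$, whose columns are $N$ independent copies of the $\mathbb R^\nu$-valued random variable $\mathbf H^{(N)}$ with pdf $p_{\mathbf H}^{(N)}$. Then $E\{[\mathbf H_N^N]\}=[0_{\nu,N}]$, $E\{\|[\mathbf H_N^N]\|^2\}=\nu N$, and the value for $m=N$ of the square of the relative distance, $d_N^2(N)=E\{\|[\mathbf H_N^N]-[\eta_d]\|^2\}/\|\eta_d\|^2$, is $$d_N^2(N)=1+\frac{N}{N-1}.$$
   Context: $\mathbb M_{\nu,N}$ is the set of real $\nu\times N$ matrices and $\|\cdot\|$ the Euclidean norm of vectors or Frobenius norm of matrices. $1\le\nu<N$ are integers, $\eta_d^1,\dots,\eta_d^N\in\mathbb R^\nu$ are given points, $[\eta_d]=[\eta_d^1\cdots\eta_d^N]\in\mathbb M_{\nu,N}$, with $\sum_j\eta_d^j=0$ and $\frac1{N-1}[\eta_d][\eta_d]^T=[I_\nu]$ (so $\|\eta_d\|^2=\nu(N-1)$). Set $s=\big(\frac4{N(\nu+2)}\big)^{1/(\nu+4)}$, $\widehat s=s\big(s^2+\frac{N-1}N\big)^{-1/2}$ and $$p_{\mathbf H}^{(N)}(\eta)=\frac1N\sum_{j=1}^N\frac1{(\sqrt{2\pi}\,\widehat s)^\nu}\exp\Big\{-\frac1{2\widehat s^2}\Big\|\frac{\widehat s}s\eta_d^j-\eta\Big\|^2\Big\},\qquad\eta\in\mathbb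 R^\nu.$$ *)

(* Defs.v *)
From HB Require Import structures.
From mathcomp Require Import all_boot all_order all_algebra.
From mathcomp Require Import all_classical all_reals all_analysis.

Set Implicit Arguments.
Unset Strict Implicit.
Unset Printing Implicit Defensive.

Import Order.TTheory GRing.Theory Num.Theory.
Import numFieldNormedType.Exports.

Local Open Scope classical_set_scope.
Local Open Scope ring_scope.

(* The library has no sigma-algebra on matrices: this is the product one,
   generated by the entries, i.e. the Borel sigma-algebra of R^(m x n). *)
Section measurable_matrix.
Context (R : realType) (m n : nat).

Definition mx_entry (ij : 'I_m * 'I_n) (M : 'M[R]_(m, n)) : R := M ij.1 ij.2.

Definition mx_sigma_algebra : set (set 'M[R]_(m, n)) :=
  <<s \bigcup_ij preimage_set_system setT (mx_entry ij) measurable >>.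

Let mx_set0 : mx_sigma_algebra set0.
Proof. exact: sigma_algebra0. Qed.

Let mx_setC A : mx_sigma_algebra A -> mx_sigma_algebra (~` A).
Proof. exact: sigma_algebraC. Qed.

Let mx_bigcup (F : (set _)^nat) : (forall i, mx_sigma_algebra (F i)) ->
  mx_sigma_algebra (\bigcup_i F i).
Proof. exact: sigma_algebra_bigcup. Qed.

Definition measure_mx_display : measure_display -> measure_display.
Proof. exact. Qed.

HB.instance Definition _ :=
  @isMeasurable.Build (measure_mx_display default_measure_display) 'M[R]_(m, n)
    mx_sigma_algebra mx_set0 mx_setC mx_bigcup.

End measurable_matrix.

Section measurable_matrix_lemmas.
Context (R : realType).

Lemma measurable_mx_entry m n (i : 'I_m) (j : 'I_n) :
  measurable_fun setT (fun M : 'M[R]_(m, n) => M i j).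
Proof.
move=> _ Y mY; apply: sub_sigma_algebra.
by exists (i, j) => //; exists Y.
Qed.

Lemma measurable_fun_mxP d (T : measurableType d) m n (f : T -> 'M[R]_(m, n)) :
  measurable_fun setT f <->
  forall i j, measurable_fun setT (fun x => f x i j).
Proof.
split=> [mf i j|mf].
  exact: (measurableT_comp (measurable_mx_entry i j) mf).
move=> _ A mA; rewrite setTI.
suff: mx_sigma_algebra (m := m) (n := n) `<=`
    image_set_system setT f measurable.
  by move=> /(_ _ mA); rewrite /image_set_system /= setTI.
apply: smallest_sub.
  by apply: sigma_algebra_image; exact: sigma_algebra_measurable.
move=> _ [[i j] _ [Y mY <-]].
rewrite /image_set_system /= !setTI.
by have := mf i j measurableT _ mY; rewrite setTI.
Qed.

End measurable_matrix_lemmas.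

Section lebesgue_cV.
Context (R : realType).

Definition cons_cV n (xv : measurableTypeR R * 'cV[R]_n) : 'cV[R]_n.+1 :=
  \col_(i < n.+1) oapp (fun k => xv.2 k 0) xv.1 (unlift ord0 i).

Definition uncons_cV n (v : 'cV[R]_n.+1) : measurableTypeR R * 'cV[R]_n :=
  (v ord0 0, \col_(k < n) v (lift ord0 k) 0).

Lemma cons_cVK n : cancel (@cons_cV n) (@uncons_cV n).
Proof.
move=> [x v]; rewrite /uncons_cV mxE unlift_none/=; congr pair.
by apply/colP => k; rewrite !mxE liftK.
Qed.

Lemma uncons_cVK n : cancel (@uncons_cV n) (@cons_cV n).
Proof.
move=> v; apply/colP => i; rewrite mxE.
by case: unliftP => [k ->|->] /=; rewrite ?mxE.
Qed.

Lemma measurable_cons_cV n : measurable_fun setT (@cons_cV n).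
Proof.
apply/measurable_fun_mxP => i j.
case: (unliftP ord0 i) => [k ->|->].
  rewrite (_ : (fun _ => _) = (fun v : 'cV[R]_n => v k 0) \o snd).
    exact: measurableT_comp (measurable_mx_entry _ _) measurable_snd.
  by apply/funext => -[x v]; rewrite mxE liftK.
rewrite (_ : (fun _ => _) = fst); first exact: measurable_fst.
by apply/funext => -[x v]; rewrite mxE unlift_none.
Qed.

Lemma measurable_uncons_cV n : measurable_fun setT (@uncons_cV n).
Proof.
apply/measurable_fun_pair; first exact: measurable_mx_entry.
apply/measurable_fun_mxP => i j.
rewrite (_ : (fun _ => _) = (fun v : 'cV[R]_n.+1 => v (lift ord0 i) 0)).
  exact: measurable_mx_entry.
by apply/funext => v; rewrite mxE.
Qed.

Section step.
Variables (n : nat) (mu : {sigma_finite_measure set 'cV[R]_n -> \bar R}).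

Definition lebesgue_consM : set 'cV[R]_n.+1 -> \bar R :=
  pushforward (lebesgue_measure \x mu)%E (@cons_cV n).

Let lebesgue_consM0 : lebesgue_consM set0 = 0%E.
Proof. by rewrite /lebesgue_consM /pushforward preimage_set0 measure0. Qed.

Let lebesgue_consM_ge0 A : (0 <= lebesgue_consM A)%E.
Proof. by rewrite /lebesgue_consM /pushforward measure_ge0. Qed.

Let lebesgue_consM_sigma_additive : semi_sigma_additive lebesgue_consM.
Proof.
move=> F mF tF mUF; rewrite /lebesgue_consM /pushforward preimage_bigcup.
apply: measure_semi_sigma_additive.
- by move=> k; rewrite -[X in measurable X]setTI; exact: measurable_cons_cV.
- apply/trivIsetP => /= i j _ _ ij; rewrite -preimage_setI.
  by move/trivIsetP : tF => /(_ _ _ _ _ ij) ->//; rewrite preimage_set0.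
- rewrite -preimage_bigcup -[X in measurable X]setTI.
  exact: measurable_cons_cV.
Qed.

HB.instance Definition _ := isMeasure.Build _ _ _ lebesgue_consM
  lebesgue_consM0 lebesgue_consM_ge0 lebesgue_consM_sigma_additive.

Let lebesgue_consM_sigma_finite : sigma_finite setT lebesgue_consM.
Proof.
have /sigma_finiteP[F [FT ndF Foo]] := sigma_finiteT (@lebesgue_measure R).
have /sigma_finiteP[G [GT ndG Goo]] := sigma_finiteT mu.
exists (fun k => @uncons_cV n @^-1` (F k `*` G k)).
  apply/esym; rewrite -subTset => v _.
  have [i _ Fi] : (\bigcup_k F k) (uncons_cV v).1 by rewrite -FT.
  have [j _ Gj] : (\bigcup_k G k) (uncons_cV v).2 by rewrite -GT.
  exists (maxn i j) => //; split.
  - by move: Fi; exact/subsetPset/ndF/leq_maxl.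
  - by move: Gj; exact/subsetPset/ndG/leq_maxr.
move=> k; have [mF Fk] := Foo k; have [mG Gk] := Goo k; split.
  rewrite -[_ @^-1` _]setTI; apply: measurable_uncons_cV => //.
  exact: measurableX.
rewrite /lebesgue_consM /pushforward -comp_preimage.
rewrite (_ : _ \o _ = id) ?preimage_id; last first.
  by apply/funext => x; exact: cons_cVK.
by rewrite product_measure1E// lte_mul_pinfty// ge0_fin_numE.
Qed.

HB.instance Definition _ := Measure_isSigmaFinite.Build _ _ _
  lebesgue_consM lebesgue_consM_sigma_finite.

End step.

(* The n-dimensional Lebesgue measure: the n-fold product of lebesgue_measure,
   transported to column vectors; on R^0 it is the unit mass. *)
Fixpoint lebesgue_cV n : {sigma_finite_measure set 'cV[R]_n -> \bar R} :=
  match n with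
  | 0 => @dirac _ 'cV[R]_0 0 R
  | n'.+1 => lebesgue_consM (lebesgue_cV n')
  end.

Lemma lebesgue_cV_box n (A : 'I_n -> set R) : (forall i, measurable (A i)) ->
  lebesgue_cV n [set v | forall i, A i (v i 0)] =
  (\prod_(i < n) lebesgue_measure (A i))%E.
Proof.
elim: n A => [|n IH] A mA /=.
  by rewrite big_ord0 diracE mem_set//= => -[].
have mB : measurable [set v : 'cV[R]_n | forall i, A (lift ord0 i) (v i 0)].
  rewrite (_ : mkset _ =
      \bigcap_(i in setT) (fun v : 'cV[R]_n => v i 0) @^-1` A (lift ord0 i)).
    apply: fin_bigcap_measurable => // i _.
    by rewrite -[_ @^-1` _]setTI; exact: measurable_mx_entry.
  by apply/seteqP; split => v /= vA i => [_|]; exact: vA.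
rewrite big_ord_recl -(IH (fun i => A (lift ord0 i)))//.
rewrite -product_measure1E//; last exact: mA.
rewrite /lebesgue_consM /pushforward; congr (product_measure1 _ _ _).
apply/seteqP; split => -[x v] /=.
  move=> Av; split=> [|i].
    by have := Av ord0; rewrite mxE unlift_none.
  by have := Av (lift ord0 i); rewrite mxE liftK.
move=> [Ax Av] i; rewrite mxE.
by case: unliftP => [k ->|->]//=; exact: Av.
Qed.

End lebesgue_cV.

Section random_elements.
Context d (T : measurableType d) (R : realType) (P : probability T R).

(* X is a random vector of R^n with probability density function p with
   respect to the Lebesgue measure. *)
Definition has_pdf n (X : T -> 'cV[R]_n) (p : 'cV[R]_n -> R) : Prop :=
  measurable_fun setT X /\
  forall A, measurable A ->
    P (X @^-1` A) = (\int[lebesgue_cV R n]_(x in A) (p x)%:E)%E.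

(* A factor is dropped from the product rule by taking A i = setT, so that the
   rule for the full family contains the rule for every subfamily. *)
Definition mutually_independent (I : finType) d' (T' : measurableType d')
    (X : I -> T -> T') : Prop :=
  forall A : I -> set T', (forall i, measurable (A i)) ->
    P (\bigcap_i (X i @^-1` A i)) = (\prod_i P (X i @^-1` A i))%E.

Definition independent_copy d' (T' : measurableType d')
    (Y X : {RV P >-> T'}) : Prop :=
  (forall A, measurable A -> distribution P Y A = distribution P X A) /\
  forall A B, measurable A -> measurable B ->
    P (Y @^-1` A `&` X @^-1` B) = (P (Y @^-1` A) * P (X @^-1` B))%E.

Definition expectation_mx m n (X : T -> 'M[R]_(m, n)) : 'M[\bar R]_(m, n) :=
  \matrix_(i, j) ('E_P[fun w => X w i j])%E.

(* The norm `|M| of the library is the max norm, hence this definition; on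
   column vectors it is the Euclidean norm. *)
Definition frobenius_norm m n (M : 'M[R]_(m, n)) : R :=
  Num.sqrt (\sum_i \sum_j M i j ^+ 2).

Definition sq_relative_distance m n (X : T -> 'M[R]_(m, n))
    (M : 'M[R]_(m, n)) : \bar R :=
  ('E_P[fun w => (frobenius_norm (X w - M) ^+ 2)%R]
     / (frobenius_norm M ^+ 2)%:E)%E.

End random_elements.

Section kernel_density.
Context (R : realType) (nu N : nat).

Definition bandwidth : R :=
  (4 / (N%:R * (nu%:R + 2))) `^ (1 / (nu%:R + 4)).

Definition modified_bandwidth : R :=
  bandwidth * (bandwidth ^+ 2 + (N%:R - 1) / N%:R) `^ (- (1 / 2)).

Definition kde (eta_d : 'M[R]_(nu, N)) (eta : 'cV[R]_nu) : R :=
  1 / N%:R * \sum_(j < N)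
    1 / (Num.sqrt (2 * pi) * modified_bandwidth) ^+ nu *
    expR (- (1 / (2 * modified_bandwidth ^+ 2)) *
      frobenius_norm
        (modified_bandwidth / bandwidth *: col j eta_d - eta) ^+ 2).

End kernel_density.

(* Main.v *)
Require Import Defs.
From HB Require Import structures.
From mathcomp Require Import all_boot all_order all_algebra.
From mathcomp Require Import all_classical all_reals all_analysis.
From mathcomp Require Import measurable_realfun ring lra.

Set Implicit Arguments.
Unset Strict Implicit.
Unset Printing Implicit Defensive.

Import Order.TTheory GRing.Theory Num.Theory.
Import numFieldNormedType.Exports.

Local Open Scope classical_set_scope.
Local Open Scope ring_scope.

(** The three claims only involve the quadratic deviations of single entries,
    Q(t) = E (H_ij - t)^2 with t real, so that everything follows from

      Q(t) = 1 + t^2   for all i, j and t.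

    The column of index j of H has density p, which is the average over the
    data points eta_k of the densities of the Gaussian vectors with
    independent components of means c * eta_ik and standard deviation sh,
    where sh is the modified bandwidth and c = sh / s
    ([kdeE]). By Tonelli's theorem for the iterated Lebesgue measure
    ([integral_prod_lebesgue_cV]) all the components but one integrate to 1,
    and a one-dimensional Gaussian integral ([integral_sqrB_normal_pdf]) gives
    Q(t) = (1 / N) * sum_k (sh^2 + (c * eta_ik - t)^2)
    ([integral_sqrB_kde]). As the data have mean 0 and
    sum_k eta_ik^2 = N - 1, this is sh^2 + c^2 * (N - 1) / N + t^2, and
    sh is tuned precisely so that sh^2 + c^2 * (N - 1) / N = 1
    ([modified_bandwidth_unit]).

    Now Q determines the rest. Since X = (X^2 - (X - 1)^2 + 1) / 2, the values
    Q(0) and Q(1) give integrability and the mean 0 ([expectation_of_sqrB]);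
    summing Q(0) over the entries gives nu * N; summing Q(eta_ij) gives
    nu * N + |eta|^2, and division by |eta|^2 = nu * (N - 1) gives
    1 + N / (N - 1). The independent copy has the law of H, hence the same Q. *)

(** * Second moments of the normal law *)

Section gaussian_moments.
Context {R : realType}.
Implicit Types (m s t x : R).
Local Notation mu := (@lebesgue_measure R).

Lemma continuous_sqrB_gauss_fun t :
  continuous (fun x : R => (x - t) ^+ 2 * gauss_fun x).
Proof.
move=> x; apply: cvgM; last exact: continuous_gauss_fun.
apply: (cvg_comp (fun x => x - t) (fun x => x ^+ 2)).
  by apply: (@cvgB _ R^o) => //; [exact: cvg_id|exact: cvg_cst].
exact: sqr_continuous.
Qed.

Lemma is_derive_gauss_fun x :
  is_derive x 1 (gauss_fun : R -> R) (- 2 * x * gauss_fun x).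
Proof.
rewrite /gauss_fun; apply: is_derive_eq.
rewrite /GRing.scale/=; ring.
Qed.

(** The boundary term of the integration by parts below: the inequality
    1 + u <= expR u at u = x ^+ 2 gives x * gauss_fun x <= x^-1. *)
Lemma cvg_mulrn_gauss_fun :
  (n.+1%:R * gauss_fun n.+1%:R : R) @[n --> \oo] --> (0 : R).
Proof.
apply: (@squeeze_cvgr _ _ _ _ (cst 0) (@harmonic R)).
- near=> n; rewrite mulr_ge0 ?gauss_fun_ge0//=.
  rewrite /gauss_fun expRN ler_pdivrMr ?expR_gt0// ler_pdivlMl// -expr2.
  by rewrite (le_trans _ (expR_ge1Dx _))// lerDr.
- exact: cvg_cst.
- exact: cvg_harmonic.
Unshelve. all: by end_near. Qed.

(** Integration by parts on [0, n + 1] of x times the derivative of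
    - gauss_fun / 2, followed by n --> oo: what remains is half of the Gauss
    integral. *)
Lemma integral0y_sqr_gauss_fun :
  (\int[mu]_(x in `[0%R, +oo[) (x ^+ 2 * gauss_fun x)%:E)%E =
  (Num.sqrt pi / 4)%:E.
Proof.
pose f x : R := x ^+ 2 * gauss_fun x.
have f0 x : 0 <= f x by rewrite mulr_ge0 ?sqr_ge0 ?gauss_fun_ge0.
have cf : continuous f.
  move=> x; rewrite [f](_ : _ = fun x : R => (x - 0) ^+ 2 * gauss_fun x).
    exact: continuous_sqrB_gauss_fun.
  by apply/funext => y; rewrite subr0.
have mf : measurable_fun setT f by exact: continuous_measurable_fun.
pose G x : R := - 2^-1 * gauss_fun x.
have dG x : is_derive x 1 G (x * gauss_fun x).
  have dg := is_derive_gauss_fun x.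
  by apply: is_derive_eq; rewrite /GRing.scale/=; field.
have cG : continuous G.
  by move=> x; apply: cvgMl_tmp; exact: continuous_gauss_fun.
have ipart n : (\int[mu]_(x in `[0%R, n.+1%:R]) (f x)%:E =
    (- 2^-1 * (n.+1%:R * gauss_fun n.+1%:R))%:E +
    (2^-1)%:E * \int[mu]_(x in `[0%R, n.+1%:R]) (gauss_fun x)%:E)%E.
  have -> : (\int[mu]_(x in `[0%R, n.+1%:R]) (f x)%:E =
      \int[mu]_(x in `[0%R, n.+1%:R]) (x * (x * gauss_fun x))%:E)%E.
    by apply: eq_integral => x _; rewrite /f expr2 mulrA.
  rewrite (@integration_by_parts _ _ G (cst 1))//.
  - rewrite mul0r subr0 /G; congr (_ + _)%E.
      by congr EFin; ring.
    under eq_integral do rewrite mul1r EFinM.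
    rewrite integralZl//=; first by rewrite EFinN mulNe oppeK.
    apply: continuous_compact_integrable; first exact: segment_compact.
    exact/continuous_subspaceT/continuous_gauss_fun.
  - exact/continuous_subspaceT/cst_continuous.
  - split => [x _| |]; first exact: derivable_id.
      exact: cvg_at_right_filter.
    exact: cvg_at_left_filter.
  - by move=> x _; rewrite derive1E derive_id.
  - apply: continuous_subspaceT => x; apply: cvgM; first exact: cvg_id.
    exact: continuous_gauss_fun.
  - split => [x _| |]; first exact: (@ex_derive _ _ _ _ _ _ _ (dG x)).
      exact/cvg_at_right_filter/cG.
    exact/cvg_at_left_filter/cG.
  - by move=> x _; rewrite derive1E (@derive_val _ _ _ _ _ _ _ (dG x)).
have := @ge0_cvgn_integral R mu _ gauss_fun_ge0 measurable_gauss_fun.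
rewrite -cvg_shiftS integral0y_gauss => cvgr.
have := @ge0_cvgn_integral R mu _ f0 mf.
rewrite -cvg_shiftS; under eq_cvg do rewrite /= ipart.
move=> cvgl; apply: (cvg_unique _ cvgl) => //.
rewrite (_ : (_ / 4)%:E = 0%E + (2^-1)%:E * (Num.sqrt pi / 2)%:E)%E; last first.
  by rewrite add0e -EFinM; congr EFin; field.
apply: cvgeD => //; last exact: cvgeZl.
apply: cvg_EFin; first by near=> n.
rewrite -[X in _ --> X](mulr0 (- 2^-1)).
by apply: cvgMl_tmp; exact: cvg_mulrn_gauss_fun.
Unshelve. all: by end_near. Qed.

(** Folding the line at 0 makes odd parts cancel inside the integrand, so that
    integrals of functions of changing sign never have to be considered. *)
Lemma ge0_integralT_fold (f : R -> R) : (forall x, 0 <= f x) -> continuous f ->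
  (\int[mu]_x (f x)%:E =
   \int[mu]_(x in `[0%R, +oo[) (f x + f (- x))%:E)%E.
Proof.
move=> f0 cf.
have mf : measurable_fun setT f by exact: continuous_measurable_fun.
have mfN : measurable_fun setT (f \o -%R) by exact: measurableT_comp.
under [RHS]eq_integral do rewrite EFinD.
rewrite ge0_integralD//=; last 4 first.
- by move=> x _; rewrite lee_fin.
- by apply/measurable_EFinP; exact: measurable_funTS.
- by move=> x _; rewrite lee_fin.
- by apply/measurable_EFinP; exact: measurable_funTS.
rewrite -(@ge0_integration_by_substitutionNy _ f 0); last 2 first.
- exact: continuous_subspaceT.
- by move=> x _.
rewrite oppr0 addeC -(setUv `]-oo, (0 : R)]) ge0_integral_setU//=; last 4 first.
- exact: measurableC.
- by rewrite setUv; exact/measurable_EFinP.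
- by move=> x _; rewrite lee_fin.
- exact/disj_setPCl.
rewrite setCitvl integral_itv_obnd_cbnd//.
by apply/measurable_EFinP; exact: measurable_funTS.
Qed.

(** After folding, (x - t)^2 + (- x - t)^2 = 2 x^2 + 2 t^2. *)
Lemma integral_sqrB_gauss_fun t :
  (\int[mu]_x ((x - t) ^+ 2 * gauss_fun x)%:E)%E =
  (Num.sqrt pi * (2^-1 + t ^+ 2))%:E.
Proof.
rewrite ge0_integralT_fold; last 2 first.
- by move=> x; rewrite mulr_ge0 ?sqr_ge0 ?gauss_fun_ge0.
- exact: continuous_sqrB_gauss_fun.
have -> : (\int[mu]_(x in `[0%R, +oo[) ((x - t) ^+ 2 * gauss_fun x +
      (- x - t) ^+ 2 * gauss_fun (- x))%:E =
    \int[mu]_(x in `[0%R, +oo[) (2%:E * (x ^+ 2 * gauss_fun x)%:E +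
      (2 * t ^+ 2)%:E * (gauss_fun x)%:E))%E.
  apply: eq_integral => x _; rewrite -!EFinM -EFinD; congr EFin.
  by rewrite /gauss_fun sqrrN; ring.
have mg := @measurable_gauss_fun R.
have mg2 : measurable_fun setT (fun x : R => x ^+ 2 * gauss_fun x).
  by apply: measurable_funM => //; exact: measurable_funX.
have g2_ge0 x : 0 <= x ^+ 2 * gauss_fun x.
  by rewrite mulr_ge0 ?sqr_ge0 ?gauss_fun_ge0.
have t_ge0 : 0 <= 2 * t ^+ 2 by rewrite mulr_ge0 ?sqr_ge0.
rewrite ge0_integralD//=; last 4 first.
- by move=> x _; rewrite -EFinM lee_fin mulr_ge0.
- by apply/measurable_EFinP; apply: measurable_funTS; exact: measurable_funM.
- by move=> x _; rewrite -EFinM lee_fin mulr_ge0 ?gauss_fun_ge0.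
- by apply/measurable_EFinP; apply: measurable_funTS; exact: measurable_funM.
rewrite !ge0_integralZl_EFin//=; last 4 first.
- by move=> x _; rewrite lee_fin gauss_fun_ge0.
- by apply/measurable_EFinP; exact: measurable_funTS.
- by move=> x _; rewrite lee_fin.
- by apply/measurable_EFinP; exact: measurable_funTS.
rewrite integral0y_sqr_gauss_fun integral0y_gauss -!EFinM -EFinD.
by congr EFin; field.
Qed.

(** The substitution y = (x - m) / (s * sqrt 2) turns the normal density into
    the Gauss function. *)
Lemma integral_sqrB_normal_pdf m s t : 0 < s ->
  (\int[mu]_x ((x - t) ^+ 2 * normal_pdf m s x)%:E)%E =
  (s ^+ 2 + (m - t) ^+ 2)%:E.
Proof.
move=> s0; have s20 : 0 < Num.sqrt 2 :> R by rewrite sqrtr_gt0.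
pose c := s * Num.sqrt 2.
have c0 : 0 < c by rewrite mulr_gt0.
have c_neq0 : c != 0 by rewrite gt_eqF.
have cE : c ^+ 2 = 2 * s ^+ 2 by rewrite exprMn sqr_sqrtr// mulrC.
have sp0 : 0 < Num.sqrt pi :> R by rewrite sqrtr_gt0 pi_gt0.
have peakE : normal_peak s = (c * Num.sqrt pi)^-1.
  congr (_^-1); rewrite -mulr_natr mulrAC sqrtrM; last first.
    by rewrite mulr_ge0 ?sqr_ge0.
  by rewrite sqrtrM ?sqr_ge0// sqrtr_sqr gtr0_norm.
pose F (x : R) := (x - m) / c.
have dF x : is_derive x 1 F c^-1.
  by apply: is_derive_eq; rewrite /GRing.scale/=; ring.
have F'E : (F^`() = cst c^-1)%classic.
  by apply/funext => x; rewrite derive1E (@derive_val _ _ _ _ _ _ _ (dF x)).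
pose G y : R := (y - (t - m) / c) ^+ 2 * gauss_fun y.
have cG : continuous G by exact: continuous_sqrB_gauss_fun.
have G0 x : 0 <= G x by rewrite mulr_ge0 ?sqr_ge0 ?gauss_fun_ge0.
have mG : measurable_fun setT G by exact: continuous_measurable_fun.
have k0 : 0 <= normal_peak s * c ^+ 3.
  by rewrite mulr_ge0 ?normal_peak_ge0 ?exprn_ge0 ?ltW.
transitivity ((normal_peak s * c ^+ 3)%:E *
    \int[mu]_x (((G \o F) * F^`()%classic) x)%:E)%E.
  rewrite -ge0_integralZl_EFin//=; last 2 first.
  - by move=> x _; rewrite F'E lee_fin mulr_ge0//= ?G0// invr_ge0 ltW.
  - rewrite F'E; apply/measurable_EFinP/measurable_funM => //.
    apply: measurableT_comp => //.
    by apply: measurable_funM => //; exact: measurable_funB.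
  apply: eq_integral => x _; rewrite -EFinM; congr EFin.
  rewrite normal_pdfE ?gt_eqF// F'E /G /F !fctE/=.
  have -> : normal_fun m s x = gauss_fun ((x - m) / c).
    congr expR; rewrite mulNr exprMn exprVn cE mulr2n.
    by congr (- (_ / _)); ring.
  by field.
rewrite -increasing_ge0_integration_by_substitutionT//.
- rewrite integral_sqrB_gauss_fun -EFinM; congr EFin.
  have -> : s ^+ 2 = c ^+ 2 / 2 by rewrite cE; field.
  by rewrite peakE; field; rewrite c_neq0 gt_eqF.
- by move=> x y xy; rewrite /F ltr_pM2r ?invr_gt0// ltrD2r.
- by rewrite F'E => ?; exact: cvg_cst.
- by rewrite F'E; exact: is_cvg_cst.
- by rewrite F'E; exact: is_cvg_cst.
- by apply/gt0_cvgMlNy; [rewrite invr_gt0|exact: cvg_addrr_Ny].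
- by apply/gt0_cvgMly; [rewrite invr_gt0|exact: cvg_addrr].
Qed.
End gaussian_moments.

(** * Integration over column vectors *)

Section column_vectors.
Context {R : realType}.
Local Notation mu := (@lebesgue_measure R).

Lemma measurable_prod_col n (f : 'I_n -> R -> R) :
  (forall k, measurable_fun setT (f k)) ->
  measurable_fun setT (fun v : 'cV[R]_n => \prod_k f k (v k 0)).
Proof.
move=> mf; apply: measurable_prod => k _.
exact: measurableT_comp (mf k) (measurable_mx_entry k 0).
Qed.

(** Tonelli's theorem, one coordinate at a time along the recursive definition
    of [lebesgue_cV]. *)
Lemma integral_prod_lebesgue_cV n (f : 'I_n -> R -> R) :
  (forall k, measurable_fun setT (f k)) -> (forall k x, 0 <= f k x) ->
  (\int[lebesgue_cV R n]_v (\prod_k f k (v k 0))%:E =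
   \prod_k \int[mu]_x (f k x)%:E)%E.
Proof.
elim: n f => [|n IH] f mf f0.
  rewrite big_ord0 /=; under eq_integral do rewrite big_ord0.
  by rewrite integral_cst// /= /dirac indicE mem_set// mule1.
have F0 k (v : 'cV[R]_k) (h : 'I_k -> R -> R) : (forall k x, 0 <= h k x) ->
    0 <= \prod_k h k (v k 0) by move=> h0; apply: prodr_ge0.
rewrite [LHS](_ : _ =
    \int[pushforward (mu \x lebesgue_cV R n)%E (@cons_cV R n)]_v
      (\prod_k f k (v k 0))%:E)%E//.
rewrite ge0_integral_pushforward//; last 3 first.
- exact: measurable_cons_cV.
- by apply/measurable_EFinP; exact: measurable_prod_col.
- by move=> v _; rewrite lee_fin F0.
rewrite preimage_setT fubini_tonelli1; last 2 first.
- apply/measurable_EFinP.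
  exact: measurableT_comp (measurable_prod_col mf) (@measurable_cons_cV R n).
- by move=> v; rewrite lee_fin F0.
pose g k := f (lift ord0 k).
rewrite big_ord_recl -(IH g)//; last 2 first.
- by move=> k; exact: mf.
- by move=> k x; exact: f0.
rewrite -ge0_integralZr//; last 3 first.
- by apply/measurable_EFinP; exact: mf.
- by move=> x _; rewrite lee_fin.
- by apply: integral_ge0 => v _; rewrite lee_fin F0// => k x; exact: f0.
apply: eq_integral => x _; rewrite /fubini_F -ge0_integralZl//; last 3 first.
- by apply/measurable_EFinP; apply: measurable_prod_col => k; exact: mf.
- by move=> v _; rewrite lee_fin F0// => k y; exact: f0.
- by rewrite lee_fin.
apply: eq_integral => v _; rewrite -EFinM; congr EFin => /=.
rewrite big_ord_recl mxE unlift_none; congr (_ * _).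
by apply: eq_bigr => k _; rewrite mxE liftK.
Qed.
End column_vectors.

Section density.
Context d (T : measurableType d) (R : realType) (P : probability T R).

(** A density is only required to give the probabilities of events. It
    coincides almost everywhere with the Radon-Nikodym derivative of the law of
    X, for which the change of variables is known. *)
Lemma ge0_integral_has_pdf n (X : T -> 'cV[R]_n) (p : 'cV[R]_n -> R)
    (f : 'cV[R]_n -> \bar R) :
  has_pdf P X p -> measurable_fun setT p -> (forall v, 0 <= p v) ->
  measurable_fun setT f -> (forall v, (0 <= f v)%E) ->
  (\int[P]_w f (X w) = \int[lebesgue_cV R n]_v (f v * (p v)%:E))%E.
Proof.
move=> [mX pX] mp p0 mf f0.
pose X' : {RV P >-> 'cV[R]_n} := mfun_Sub (mem_set mX).
pose nu := distribution P X'; pose mu := lebesgue_cV R n.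
have mpE : measurable_fun setT (EFin \o p) by exact/measurable_EFinP.
have numu : nu `<< mu.
  apply/null_content_dominatesP => A mA muA0.
  rewrite /nu/= /distribution /pushforward pX//.
  by apply: null_set_integral => //; exact: measurable_funTS.
have pE : ae_eq mu setT (Radon_Nikodym_SigmaFinite.f nu mu) (EFin \o p).
  apply: integral_ae_eq => //.
    exact: Radon_Nikodym_SigmaFinite.f_integrable.
  move=> A _ mA; rewrite -Radon_Nikodym_SigmaFinite.f_integral//.
  exact: pX.
rewrite -(ge0_integral_distribution X' mf f0).
rewrite -(Radon_Nikodym_SigmaFinite.change_of_variables numu)//.
apply: ae_eq_integral => //; last exact: ae_eqe_mul2l.
- apply: emeasurable_funM => //; apply: measurable_int.
  exact: Radon_Nikodym_SigmaFinite.f_integrable.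
- exact: emeasurable_funM.
Qed.
End density.

(** * The kernel density estimate and its bandwidths *)

Section kernel_density_estimate.
Context {R : realType} (nu N : nat) (eta : 'M[R]_(nu, N)).
Local Notation s := (bandwidth R nu N).
Local Notation sh := (modified_bandwidth R nu N).

Lemma frobenius_norm_sqr m n (M : 'M[R]_(m, n)) :
  frobenius_norm M ^+ 2 = \sum_i \sum_j M i j ^+ 2.
Proof.
rewrite sqr_sqrtr// sumr_ge0// => i _; rewrite sumr_ge0// => j _.
exact: sqr_ge0.
Qed.

(** The isotropic Gaussian kernel factors over the coordinates. *)
Lemma kdeE v : 0 < sh ->
  kde eta v = N%:R^-1 * \sum_(j < N) \prod_(k < nu)
    normal_pdf (sh / s * eta k j) sh (v k 0).
Proof.
move=> sh0; rewrite /kde div1r; congr (_ * _); apply: eq_bigr => j _.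
under eq_bigr do rewrite normal_pdfE ?gt_eqF//.
rewrite big_split prodr_const card_ord -expR_sum; congr (_ * expR _).
  rewrite div1r -exprVn; congr (_^-1 ^+ _).
  rewrite -(mulr_natr (_ * pi)) -mulrA [in RHS]sqrtrM ?sqr_ge0//.
  by rewrite sqrtr_sqr gtr0_norm// mulrC (mulrC pi).
rewrite frobenius_norm_sqr mulr_sumr; apply: eq_bigr => k _.
rewrite big_ord1 !mxE; move: (sh / s * eta k j) => m; field.
by rewrite gt_eqF.
Qed.

Lemma integral_sqrB_kde (i : 'I_nu) t : 0 < sh ->
  (\int[lebesgue_cV R nu]_v (((v i 0 - t) ^+ 2)%:E * (kde eta v)%:E) =
  (N%:R^-1 * \sum_(j < N) (sh ^+ 2 + (sh / s * eta i j - t) ^+ 2))%:E)%E.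
Proof.
move=> sh0.
(* Only the coordinate of index i carries the weight (x - t)^2. *)
pose h j k x := (if k == i then (x - t) ^+ 2 else 1) *
  normal_pdf (sh / s * eta k j) sh x.
have h0 j k x : 0 <= h j k x.
  by rewrite mulr_ge0 ?normal_pdf_ge0//; case: ifP => // _; exact: sqr_ge0.
have mh j k : measurable_fun setT (h j k).
  apply: measurable_funM; last exact: measurable_normal_pdf.
  by case: (k == i) => //; apply: measurable_funX; exact: measurable_funB.
have prodE j v : (v i 0 - t) ^+ 2 * \prod_(k < nu)
    normal_pdf (sh / s * eta k j) sh (v k 0) = \prod_k h j k (v k 0).
  rewrite /h big_split/=; congr (_ * _).
  by rewrite (bigD1 i)//= eqxx big1 ?mulr1// => k /negPf ->.
transitivity (\int[lebesgue_cV R nu]_v ((N%:R^-1)%:E *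
    \sum_(j < N) (\prod_k h j k (v k 0))%:E))%E.
  apply: eq_integral => v _; rewrite sumEFin -!EFinM kdeE//; congr EFin.
  by rewrite mulrCA mulr_sumr; congr (_ * _); apply: eq_bigr => j _.
have mprod j :
    measurable_fun setT (fun v : 'cV_nu => (\prod_k h j k (v k 0))%:E).
  by apply/measurable_EFinP; exact: measurable_prod_col.
have prod0 j (v : 'cV_nu) : (0 <= (\prod_k h j k (v k 0))%:E)%E.
  by rewrite lee_fin prodr_ge0.
rewrite ge0_integralZl_EFin//; last 2 first.
- by move=> v _; exact: sume_ge0.
- exact: emeasurable_sum.
rewrite EFinM ge0_integral_sum// -sumEFin; congr (_ * _)%E.
apply: eq_bigr => j _; rewrite integral_prod_lebesgue_cV//.
rewrite (bigD1 i)//= big1 ?mule1 => [|k /negPf ki]; rewrite /h ?eqxx ?ki.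
  exact: integral_sqrB_normal_pdf.
under eq_integral do rewrite mul1r.
exact: integral_normal_pdf.
Qed.

Lemma measurable_kde : 0 < sh -> measurable_fun setT (kde eta).
Proof.
move=> sh0; pose q j k := normal_pdf (sh / s * eta k j) sh.
rewrite (_ : kde eta =
    fun v => N%:R^-1 * \sum_(j < N) \prod_(k < nu) q j k (v k 0)).
  apply: measurable_funM => //; apply: measurable_sum => j.
  by apply: measurable_prod_col => k; exact: measurable_normal_pdf.
by apply/funext => v; exact: kdeE.
Qed.

Lemma kde_ge0 v : 0 < sh -> 0 <= kde eta v.
Proof.
move=> sh0; rewrite kdeE// mulr_ge0 ?invr_ge0// sumr_ge0// => j _.
by rewrite prodr_ge0// => k _; exact: normal_pdf_ge0.
Qed.

Context (N1 : (1 < N)%N).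

Lemma bandwidth_gt0 : 0 < s.
Proof. by rewrite powR_gt0// divr_gt0// mulr_gt0 ?ltr0n ?(ltnW N1). Qed.

Let scale0 : 0 < s ^+ 2 + (N%:R - 1) / N%:R.
Proof.
rewrite addr_gt0 ?exprn_gt0 ?bandwidth_gt0// divr_gt0 ?ltr0n ?(ltnW N1)//.
by rewrite subr_gt0 ltr1n.
Qed.

Lemma modified_bandwidth_gt0 : 0 < sh.
Proof. by rewrite mulr_gt0 ?bandwidth_gt0// powR_gt0. Qed.

(** The defining property of the modified bandwidth: shrinking the data by
    sh / s gives each coordinate of the mixture the variance 1, the sum of the
    kernel variance sh^2 and of the variance of the shrunk centres, where
    (N - 1) / N is the variance over N points of standardized data. *)
Lemma modified_bandwidth_unit :
  sh ^+ 2 + (sh / s) ^+ 2 * ((N%:R - 1) / N%:R) = 1.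
Proof.
have s0 := bandwidth_gt0.
have shE : (sh / s) ^+ 2 = (s ^+ 2 + (N%:R - 1) / N%:R)^-1.
  rewrite mulrAC divff ?gt_eqF// mul1r powRN div1r powR12_sqrt ?ltW//.
  by rewrite exprVn sqr_sqrtr// ltW.
have -> : sh ^+ 2 = (sh / s) ^+ 2 * s ^+ 2 by rewrite -exprMn divfK ?gt_eqF.
by rewrite -mulrDr shE mulVf// gt_eqF.
Qed.

End kernel_density_estimate.

(** * Moments of random variables and matrices *)

Section moments.
Context d (T : measurableType d) (R : realType) (P : probability T R).

(** The quadratic deviations around 0 and 1 already determine the mean, as
    X = (X^2 - (X - 1)^2 + 1) / 2. *)
Lemma expectation_of_sqrB (X : T -> R) (m v : R) : measurable_fun setT X ->
  (forall t, 'E_P[fun w => ((X w - t) ^+ 2)%R]%E = (v + (m - t) ^+ 2)%:E) ->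
  'E_P[X]%E = m%:E.
Proof.
move=> mX EX.
have iX t : P.-integrable setT (fun w => ((X w - t) ^+ 2)%:E).
  apply/integrableP; split.
    by apply/measurable_EFinP/measurable_funX; exact: measurable_funB.
  under eq_integral do rewrite gee0_abs ?lee_fin ?sqr_ge0//.
  by have := EX t; rewrite unlock => ->; rewrite ltry.
have i1 : P.-integrable setT (cst 1%:E).
  by apply: finite_measure_integrable_cst.
rewrite unlock.
transitivity (\int[P]_w ((2^-1)%:E *
    (((X w - 0) ^+ 2)%:E - ((X w - 1) ^+ 2)%:E + 1%:E)))%E.
  by apply: eq_integral => w _; rewrite -EFinB -EFinD -EFinM; congr EFin; field.
rewrite integralZl//; last by apply: integrableD => //; exact: integrableB.
rewrite integralD//; last exact: integrableB.
rewrite integralB//=.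
have := EX 0; have := EX 1; rewrite unlock => -> ->.
rewrite integral_cst// mul1e [X in (_ + X)%E](probability_setT P).
by rewrite -EFinB -EFinD -EFinM; congr EFin; field.
Qed.

Lemma expectation_frobenius_norm_sqr m n (X : T -> 'M[R]_(m, n))
    (v : 'I_m -> 'I_n -> R) :
  measurable_fun setT X ->
  (forall i j, 'E_P[fun w => (X w i j ^+ 2)%R]%E = (v i j)%:E) ->
  'E_P[fun w => (frobenius_norm (X w) ^+ 2)%R]%E = (\sum_i \sum_j v i j)%:E.
Proof.
move=> /measurable_fun_mxP mX EX; rewrite unlock.
have mX2 i j : measurable_fun setT (fun w => (X w i j ^+ 2)%:E).
  by apply/measurable_EFinP; exact: measurable_funX.
have X2_ge0 i j w : (0 <= (X w i j ^+ 2)%:E)%E by rewrite lee_fin sqr_ge0.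
under eq_integral.
  move=> w _; rewrite frobenius_norm_sqr -sumEFin.
  under eq_bigr do rewrite -sumEFin.
  over.
rewrite ge0_integral_sum//; last 2 first.
- by move=> i; exact: emeasurable_sum.
- by move=> i w _; exact: sume_ge0.
rewrite -sumEFin; apply: eq_bigr => i _.
rewrite ge0_integral_sum// -sumEFin; apply: eq_bigr => j _.
by have := EX i j; rewrite unlock.
Qed.

Lemma ge0_expectation_same_distribution d' (T' : measurableType d')
    (X Y : {RV P >-> T'}) (f : T' -> R) :
  (forall A, measurable A -> distribution P Y A = distribution P X A) ->
  measurable_fun setT f -> (forall x, 0 <= f x) ->
  'E_P[f \o Y]%E = 'E_P[f \o X]%E.
Proof.
move=> XY mf f0.
have mfE : measurable_fun setT (EFin \o f) by exact/measurable_EFinP.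
rewrite unlock -(@ge0_integral_distribution _ _ _ _ _ _ Y (EFin \o f))//.
rewrite -(@ge0_integral_distribution _ _ _ _ _ _ X (EFin \o f))//.
by apply: eq_measure_integral => A mA _; exact: XY.
Qed.

End moments.

(** * Standardized data *)

Section standardized_data.
Context {R : realType} (nu N : nat) (eta : 'M[R]_(nu, N)).
Context (N1 : (1 < N)%N).
Context (eta_mean : \sum_(j < N) col j eta = 0).
Context (eta_cov : (1 / (N%:R - 1)) *: (eta *m eta^T) = 1%:M).

Let N1_neq0 : N%:R - 1 != 0 :> R.
Proof. by rewrite subr_eq0 pnatr_eq1 gtn_eqF. Qed.

Lemma sum_row_eq0 i : \sum_j eta i j = 0.
Proof.
have /colP/(_ i) := eta_mean; rewrite summxE mxE => eta0.
by rewrite -[RHS]eta0; apply: eq_bigr => j _; rewrite mxE.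
Qed.

Lemma sum_row_sqr i : \sum_j eta i j ^+ 2 = N%:R - 1.
Proof.
have /matrixP/(_ i i) := eta_cov; rewrite !mxE eqxx div1r => eta1.
rewrite -[RHS]mulr1 -[X in _ = _ * X]eta1 mulVKf//.
by apply: eq_bigr => j _; rewrite mxE expr2.
Qed.

Lemma frobenius_norm_sqr_data : frobenius_norm eta ^+ 2 = nu%:R * (N%:R - 1).
Proof.
rewrite frobenius_norm_sqr; under eq_bigr do rewrite sum_row_sqr.
by rewrite sumr_const card_ord mulr_natl.
Qed.

Context d (T : measurableType d) (P : probability T R).

(** The value of Q(t): the cross term vanishes because the data are centred, and
    the mixture has unit variance by [modified_bandwidth_unit]. *)
Lemma expectation_sqrB_kde (X : T -> 'cV[R]_nu) i t : has_pdf P X (kde eta) ->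
  'E_P[fun w => ((X w i 0 - t) ^+ 2)%R]%E = (1 + t ^+ 2)%:E.
Proof.
move=> pX; have sh0 := modified_bandwidth_gt0 (R := R) nu N1.
have N0 : N%:R != 0 :> R by rewrite pnatr_eq0 gtn_eqF// ltnW.
rewrite unlock.
rewrite (ge0_integral_has_pdf (f := fun v => ((v i 0 - t) ^+ 2)%:E) pX);
  last 4 first.
- exact: measurable_kde.
- by move=> v; exact: kde_ge0.
- apply/measurable_EFinP/measurable_funX/measurable_funB => //.
  exact: measurable_mx_entry.
- by move=> v; rewrite lee_fin sqr_ge0.
rewrite integral_sqrB_kde//; congr EFin.
rewrite -[X in _ = X + _](modified_bandwidth_unit nu N1).
set sh := modified_bandwidth _ _ _; set c := sh / _.
have -> : \sum_j (sh ^+ 2 + (c * eta i j - t) ^+ 2) =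
    \sum_j ((sh ^+ 2 + t ^+ 2) + c ^+ 2 * eta i j ^+ 2 - 2 * c * t * eta i j).
  by apply: eq_bigr => j _; ring.
rewrite sumrB big_split/= -!mulr_sumr sum_row_eq0 sum_row_sqr.
by rewrite sumr_const card_ord; field.
Qed.

End standardized_data.

Theorem lemma2 (R : realType) (nu N : nat) (eta_d : 'M[R]_(nu, N))
    (d : measure_display) (T : measurableType d) (P : probability T R)
    (H HN : {RV P >-> 'M[R]_(nu, N)}) :
  (1 <= nu < N)%N ->
  \sum_(j < N) col j eta_d = 0 ->
  (1 / (N%:R - 1)) *: (eta_d *m eta_d^T) = 1%:M ->
  (forall j : 'I_N, has_pdf P (fun w => col j (H w)) (kde eta_d)) ->
  mutually_independent P (fun (j : 'I_N) w => col j (H w)) ->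
  independent_copy HN H ->
  [/\ expectation_mx P HN = const_mx 0%E,
      'E_P[fun w => (frobenius_norm (HN w) ^+ 2)%R]%E = (nu * N)%:R%:E
    & sq_relative_distance P HN eta_d = (1 + N%:R / (N%:R - 1))%:E].
Proof.
move=> /andP[nu1 nuN] eta_mean eta_cov pH _ [HHN _].
have N1 : (1 < N)%N by exact: leq_ltn_trans nuN.
have mHN : measurable_fun setT HN by exact: measurable_funP.
have EHN i j t : 'E_P[fun w => ((HN w i j - t) ^+ 2)%R]%E = (1 + t ^+ 2)%:E.
  have mf : measurable_fun setT (fun M : 'M[R]_(nu, N) => (M i j - t) ^+ 2).
    apply/measurable_funX/measurable_funB => //.
    exact: measurable_mx_entry.
  rewrite (ge0_expectation_same_distribution HHN mf); last first.
    by move=> M; exact: sqr_ge0.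
  rewrite -(expectation_sqrB_kde N1 eta_mean eta_cov i t (pH j)).
  by congr expectation; apply/funext => w /=; rewrite mxE.
split.
- apply/matrixP => i j; rewrite !mxE.
  apply: (@expectation_of_sqrB _ _ _ _ _ 0 1).
    by move/measurable_fun_mxP : mHN.
  by move=> t; rewrite EHN sub0r sqrrN.
- rewrite (expectation_frobenius_norm_sqr (v := fun _ _ => 1))//; last first.
    move=> i j; have := EHN i j 0; rewrite expr0n addr0 => <-.
    by congr expectation; apply/funext => w; rewrite subr0.
  by rewrite !sumr_const !card_ord -mulrnA mulnC.
- rewrite /sq_relative_distance.
  rewrite (expectation_frobenius_norm_sqr
    (v := fun i j => 1 + eta_d i j ^+ 2)); last 2 first.
  + apply/measurable_fun_mxP => i j; under eq_fun do rewrite !mxE.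
    by apply: measurable_funB => //; move/measurable_fun_mxP : mHN.
  + move=> i j; rewrite -(EHN i j); congr expectation; apply/funext => w.
    by rewrite !mxE.
  have nu0 : nu%:R != 0 :> R by rewrite pnatr_eq0 -lt0n.
  have N10 : N%:R - 1 != 0 :> R by rewrite subr_eq0 pnatr_eq1 gtn_eqF.
  rewrite frobenius_norm_sqr_data// inver mulf_eq0 (negPf nu0) (negPf N10)/=.
  under eq_bigr do rewrite big_split/= sum_row_sqr// sumr_const card_ord.
  rewrite sumr_const card_ord -mulr_natl -EFinM; congr EFin; field.
  by rewrite N10 nu0.
Qed.
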